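(* Let $t$ and $k$ be integers with $t\geq k\geq 1$, and let $G$ be a $t$-connected graph of order $n\geq\max\left\{\frac{15t-11k+29}{2},\ t^{2}+\frac{5}{2}t+2\right\}$, where $n\equiv k \pmod 2$. If $$\rho(G)\geq \rho\bigl(K_{t}\vee (K_{n+k-2t-1}+(t-k+1)K_{1})\bigr),$$ then $G$ is $k$-factor-critical unless $G\cong K_{t}\vee (K_{n+k-2t-1}+(t-k+1)K_{1})$.
   Context: All graphs are finite, simple and undirected. The order of a graph is its number of vertices. The spectral radius $\rho(G)$ is the largest eigenvalue of the adjacency matrix of $G$. A connected graph is called $t$-connected if it has more than $t$ vertices and remains connected whenever fewer than $t$ vertices are removed. A graph $G$ is $k$-factor-critical if $G-S$ has a perfect matching for every $S\subseteq V(G)$ with $|S|=k$. $K_m$ is the complete graph on $m$ vertices; $G+H$ is the disjoint union of vertex-disjoint graphs $G$ and $H$; $sG$ is the disjoint union of $s$ copies of $G$; the join $G\vee H$ is obtained from $G+H$ by adding all edges between $V(G)$ and $V(H)$. *)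

(* Defs.v *)
From HB Require Import structures.
From mathcomp Require Import classical_sets reals.
From mathcomp Require Import all_boot all_order all_algebra.

Set Implicit Arguments.
Unset Strict Implicit.
Unset Printing Implicit Defensive.

Import Order.TTheory GRing.Theory Num.Theory.

Local Open Scope ring_scope.

Record sgraph := SGraph {
  vertex :> finType;
  adj : rel vertex;
  adj_sym : symmetric adj;
  adj_irrefl : irreflexive adj }.

Definition isomorphic (G H : sgraph) : Prop :=
  exists2 f : G -> H, bijective f & forall x y, adj (f x) (f y) = adj x y.

Section Constructions.

Lemma complete_sym m : symmetric (fun x y : 'I_m => x != y).
Proof. by move=> x y; rewrite eq_sym. Qed.

Lemma complete_irrefl m : irreflexive (fun x y : 'I_m => x != y).
Proof. by move=> x; rewrite eqxx. Qed.

Definition complete (m : nat) : sgraph :=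
  SGraph (@complete_sym m) (@complete_irrefl m).

Variables G H : sgraph.

Definition sum_adj (across : bool) : rel (G + H) := fun u v =>
  match u, v with
  | inl x, inl y => adj x y
  | inr x, inr y => adj x y
  | _, _ => across
  end.

Lemma sum_adj_sym b : symmetric (sum_adj b).
Proof. by move=> [x|x] [y|y] //=; rewrite adj_sym. Qed.

Lemma sum_adj_irrefl b : irreflexive (sum_adj b).
Proof. by move=> [x|x] /=; rewrite adj_irrefl. Qed.

Definition disjoint_union : sgraph :=
  SGraph (sum_adj_sym false) (sum_adj_irrefl false).

Definition graph_join : sgraph :=
  SGraph (sum_adj_sym true) (sum_adj_irrefl true).

Variable s : nat.

Definition copies_adj : rel ('I_s * G) :=
  fun u v => (u.1 == v.1) && adj u.2 v.2.

Lemma copies_adj_sym : symmetric copies_adj.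
Proof. by move=> u v; rewrite /copies_adj eq_sym adj_sym. Qed.

Lemma copies_adj_irrefl : irreflexive copies_adj.
Proof. by move=> u; rewrite /copies_adj adj_irrefl andbF. Qed.

Definition copies : sgraph := SGraph copies_adj_sym copies_adj_irrefl.

Variable S : {set G}.

Definition delete_adj : rel {x : G | x \notin S} :=
  fun u v => adj (val u) (val v).

Lemma delete_adj_sym : symmetric delete_adj.
Proof. by move=> u v; rewrite /delete_adj adj_sym. Qed.

Lemma delete_adj_irrefl : irreflexive delete_adj.
Proof. by move=> u; rewrite /delete_adj adj_irrefl. Qed.

Definition delete : sgraph := SGraph delete_adj_sym delete_adj_irrefl.

End Constructions.

Definition graph_connected (G : sgraph) : Prop :=
  (0 < #|G|)%N /\ forall x y : G, connect (@adj G) x y.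

Definition t_connected (t : nat) (G : sgraph) : Prop :=
  [/\ graph_connected G, (t < #|G|)%N &
      forall S : {set G}, (#|S| < t)%N -> graph_connected (delete S)].

Definition is_edge (G : sgraph) (e : {set G}) : Prop :=
  exists x y : G, adj x y /\ e = [set x; y]%SET.

Definition perfect_matching (G : sgraph) (M : {set {set G}}) : Prop :=
  (forall e, e \in M -> is_edge e) /\ partition M [set: G]%SET.

Definition factor_critical (k : nat) (G : sgraph) : Prop :=
  forall S : {set G}, #|S| = k ->
    exists M : {set {set delete S}}, perfect_matching M.

Definition adjacency_matrix (R : realType) (G : sgraph) : 'M[R]_#|G| :=
  \matrix_(i, j) (adj (enum_val i) (enum_val j))%:R.

(* The adjacency matrix is real symmetric, so for a nonempty graph this set of
   (real) eigenvalues is finite and nonempty, and its sup is its maximum. *)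
Definition spectral_radius (R : realType) (G : sgraph) : R :=
  sup [set a : R | eigenvalue (adjacency_matrix R G) a]%classic.

(* The subtractions are truncated; they are exact when k <= t and
   2 * t + 1 <= n + k, in which case the graph has n vertices. *)
Definition extremal_graph (n t k : nat) : sgraph :=
  graph_join (complete t)
    (disjoint_union (complete (n + k - 2 * t - 1)%N)
                    (copies (complete 1%N) (t - k + 1))).

(* Main.v *)
Require Import Defs.
From mathcomp Require Import classical_sets reals.
From mathcomp Require Import all_boot all_order all_algebra.
From mathcomp Require Import zify ring lra.
From mathcomp Require Import polyrcf.

(* If [G] is not [k]-factor-critical, some vertex set [S] leaves at least
   [|S| - k + 2] pairwise separated parts; with Gallai's lemma these parts are
   the classes of vertices that no optimal matching misses simultaneously, so
   that no parity of components is involved.  By [t]-connectedness [|S| >= t].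
   Put [a = n + k - t - 2], so that [a + 1] is the order of the largest clique of
   the extremal graph [H]; thus [rho(H) > a].  Hong's bound
   [rho(G)^2 <= 2 m - n + 1] gives [rho(G) <= a] unless [|S| = t], there are
   exactly [t - k + 2] parts and only one of them is nontrivial.  Then [G] is a
   spanning subgraph of [H], and comparing an eigenfunction of [G] with the
   positive eigenfunction of [H] shows that [G] is [H]. *)

Import Order.TTheory GRing.Theory Num.Theory.
Set Implicit Arguments.
Unset Strict Implicit.
Unset Printing Implicit Defensive.

(** * Matchings *)

Section Matching.

Variables (T : finType) (e : rel T).
Hypothesis e_sym : symmetric e.

(** A matching is encoded as an involution whose fixed points are the uncovered vertices. It acts on
    all of [T] and fixes everything outside [A], so matchings of different subsets can be compared
    and switched directly. *)
Definition matching (A : {set T}) (m : {ffun T -> T}) :=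
  [forall x, (m (m x) == x) && ((m x != x) ==> (x \in A) && e x (m x))].

Definition missed (A : {set T}) (m : {ffun T -> T}) := [set x in A | m x == x].

Lemma matchingP (A : {set T}) (m : {ffun T -> T}) :
  reflect (involutive m /\ forall x, m x != x -> x \in A /\ e x (m x))
          (matching A m).
Proof.
apply: (iffP forallP) => [H|[mK mE] x].
  split=> x; first by case/andP: (H x) => /eqP.
  by move=> mx; case/andP: (H x) => _; rewrite mx => /andP[].
by rewrite mK eqxx; apply/implyP => /mE[-> ->].
Qed.

Lemma matching_id A : matching A [ffun x => x].
Proof. by apply/matchingP; split=> [x|x]; rewrite !ffunE ?eqxx. Qed.

Lemma matching_moved A m x : matching A m -> (m x \in A) = (x \in A).
Proof.
case/matchingP=> mK mE; have [->//|mx] := eqVneq (m x) x.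
have [-> _] := mE _ mx; have mmx: m (m x) != m x by rewrite mK eq_sym.
by have [-> _] := mE _ mmx.
Qed.

Lemma mem_pair (m : T -> T) x y :
  involutive m -> y \in [set x; m x] -> [set y; m y] = [set x; m x].
Proof. by move=> mK /set2P[]->//; rewrite mK setUC. Qed.

Lemma partition_pairs (m : T -> T) (B : {set T}) :
  involutive m -> {in B, forall x, m x \in B} ->
  partition [set [set x; m x] | x in B] B.
Proof.
move=> mK mB; apply/and3P; split.
- apply/eqP/setP=> x; apply/bigcupP/idP.
    by case=> _ /imsetP[y yB ->] /set2P[]->//; apply: mB.
  by move=> xB; exists [set x; m x]; [apply: imset_f | rewrite set21].
- apply/trivIsetP=> _ _ /imsetP[x xB ->] /imsetP[y yB ->].
  rewrite -setI_eq0; apply: contraR => /set0Pn[z /setIP[zx zy]].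
  by rewrite -(mem_pair mK zx) -(mem_pair mK zy).
- by apply/imsetP=> -[x _ /setP/(_ x)]; rewrite set21 inE.
Qed.

Lemma even_involution (m : T -> T) (B : {set T}) :
  involutive m -> {in B, forall x, m x \in B} -> {in B, forall x, m x != x} ->
  ~~ odd #|B|.
Proof.
move=> mK mB mN; rewrite (card_uniform_partition _ (partition_pairs mK mB) (n := 2)).
  by rewrite muln2 odd_double.
by move=> _ /imsetP[x xB ->]; rewrite cards2 eq_sym mN.
Qed.

(** The covered vertices of [A] split into pairs under [m], so their number is even. *)
Lemma odd_missed A m : matching A m -> odd #|missed A m| = odd #|A|.
Proof.
move=> mA; have /matchingP[mK mE] := mA.
rewrite -(cardsID (missed A m) A) (setIidPr _) ?oddD; last first.
  by apply/subsetP=> x; rewrite inE => /andP[].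
suff /negPf->: ~~ odd #|A :\: missed A m| by rewrite addbF.
apply: (even_involution mK) => x; rewrite !inE.
  by rewrite mK (matching_moved _ mA) [x == _]eq_sym.
by case/andP=> mx xA; rewrite xA in mx.
Qed.

(** The orbit of [y] under [h = g \o f] is the alternating path starting at the vertex [y] missed by
    [g]. Conjugation by [g] inverts [h] and [g] fixes [y], so [g] sends [h^j y] to [h^(-j) y];
    closure under [f = g \o h] follows. *)
Lemma alternating_closed (f g : T -> T) y x :
  involutive f -> involutive g -> g y = y ->
  fconnect (g \o f) y x -> fconnect (g \o f) y (g x) /\ fconnect (g \o f) y (f x).
Proof.
move=> fK gK gy; pose h := g \o f; have hI : injective h.
  by apply: inj_comp; apply: inv_inj.
have gC u : fconnect h y u -> fconnect h y (g u).
  case/connectP=> p /fpathP[j ->] ->; rewrite last_traject.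
  elim: j => [|j IH] /=; first by rewrite gy.
  apply: (connect_trans IH); rewrite (fconnect_sym hI).
  by apply/connect1/eqP; rewrite /h /= gK fK.
move=> yx; split; first exact: gC.
rewrite -[f x]gK; apply: gC; apply: (connect_trans yx).
exact: (fconnect1 h).
Qed.

(** Only the far end of the alternating path can be missed by [f]. *)
Lemma alternating_end (f g : T -> T) y x z :
  involutive f -> involutive g -> g y = y -> f x = x -> f z = z ->
  fconnect (g \o f) y x -> fconnect (g \o f) y z -> x = z.
Proof.
move=> fK gK gy; pose h := g \o f; have hI : injective h.
  by apply: inj_comp; apply: inv_inj.
have fh u i : iter i h (f (iter i h u)) = f u.
  elim: i u => //= i IH u; rewrite -iterS iterSr -[RHS](IH u).
  by rewrite {2 3}/h /= fK gK.
(* If [u = h^i y] is fixed by [f], then [h^(2i+1) y = y], so the orbit length divides [2i+1]. As [i]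
   is below that length, the two are equal, and the orbit alone determines [i]. *)
have half u : f u = u -> fconnect h y u -> (findex h y u).*2.+1 = order h y.
  move=> fu yu; set i := findex h y u; have ui: u = iter i h y by rewrite iter_findex.
  have ir : i < order h y by apply: findex_max.
  have hi : iter i.*2.+1 h y = y.
    by rewrite iterS -addnn iterD -ui -[X in iter i h X]fu ui fh /h /= fK.
  have [lt_r|] := ltnP i.*2.+1 (order h y).
    by have := findex_iter lt_r; rewrite hi findex0.
  rewrite leq_eqVlt => /predU1P[->//|lt_r].
  have d_lt : i.*2.+1 - order h y < order h y.
    by rewrite ltn_subLR ?(ltnW lt_r) // addnn ltn_Sdouble.
  have := findex_iter d_lt.
  rewrite -[X in findex _ _ (iter _ _ X)](iter_order hI) -iterD subnK ?(ltnW lt_r) //.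
  by rewrite hi findex0 => /esym/eqP; rewrite subn_eq0 leqNgt lt_r.
move=> fx fz yx yz.
rewrite -(iter_findex yx) -(iter_findex yz); congr iter.
by apply: double_inj; apply: succn_inj; rewrite !half.
Qed.
Definition switch (O : {set T}) (f g : {ffun T -> T}) :=
  [ffun x => if x \in O then f x else g x].

Section Switch.

Variables (A O : {set T}) (f g : {ffun T -> T}).
Hypotheses (fO : forall x, x \in O -> f x \in O)
           (gO : forall x, x \in O -> g x \in O).

Lemma switch_matching :
  matching A f -> matching A g -> matching A (switch O f g).
Proof.
move=> /matchingP[fK fE] /matchingP[gK gE]; apply/matchingP.
have inE x : x \in O -> switch O f g x = f x by move=> xO; rewrite ffunE xO.
have outE x : x \notin O -> switch O f g x = g x.
  by move=> xO; rewrite ffunE (negPf xO).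
split=> x; have [xO|xO] := boolP (x \in O).
- by rewrite inE // inE ?fK // fO.
- by rewrite outE // outE ?gK //; apply: contra xO => /gO; rewrite gK.
- by rewrite inE //; apply: fE.
- by rewrite outE //; apply: gE.
Qed.

Lemma card_missed_switch :
  #|missed A (switch O f g)| =
  #|missed A f :&: O| + #|missed A g :\: O|.
Proof.
rewrite -(cardsID O); congr (_ + _); apply: eq_card => x; rewrite !inE ffunE.
  by case: (x \in O); rewrite ?andbF.
by case: (x \in O).
Qed.

End Switch.

(** * Gallai's lemma *)

Section Optimal.

Variables (A : {set T}) (d : nat).
Hypothesis min_d : forall m, matching A m -> d <= #|missed A m|.

Definition optimal m := matching A m && (#|missed A m| == d).

(** The first disjunct makes the relation reflexive: a single vertex may well be missed by an
    optimal matching. *)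
Definition inseparable : rel T := fun x y =>
  (x == y) || ~~ [exists m, [&& optimal m, m x == x & m y == y]].

Lemma inseparable_sym : symmetric inseparable.
Proof.
move=> x y; rewrite /inseparable eq_sym; congr (_ || ~~ _).
by apply: eq_existsb => m; rewrite [(m x == x) && _]andbC.
Qed.

(* If [M] misses [x] and [z] and [N] misses [y], the alternating path starting
   at [y] reaches at most one of [x] and [z]; switching along it yields a
   matching that misses [y] and the other one, still optimal because both
   switched matchings together miss as many vertices as [M] and [N]. *)
Lemma inseparable_trans y :
  (exists2 N, optimal N & N y = y) ->
  {in A, forall x, {in A, forall z,
    inseparable x y -> inseparable y z -> inseparable x z}}.
Proof.
move=> [N optN Ny] x xA z zA.
have [<-//|xy] := eqVneq x y; have [<-//|yz] := eqVneq y z.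
rewrite /inseparable (negPf xy) (negPf yz) /=.
have [//|xz /= nxy nyz] := eqVneq x z.
apply/existsP=> -[M /and3P[optM /eqP Mx /eqP Mz]].
have /andP[mM /eqP dM] := optM; have /andP[mN /eqP dN] := optN.
have /matchingP[MK _] := mM; have /matchingP[NK _] := mN.
pose O := [set u | fconnect (N \o M) y u].
have NO u : u \in O -> N u \in O.
  by rewrite !inE => /(alternating_closed MK NK Ny)[].
have MO u : u \in O -> M u \in O.
  by rewrite !inE => /(alternating_closed MK NK Ny)[].
have yO : y \in O by rewrite inE connect0.
have optS : optimal (switch O N M).
  rewrite /optimal switch_matching //=.
  have le2 := min_d (switch_matching MO NO mM mN).
  rewrite eqn_leq min_d ?switch_matching // andbT -(leq_add2r d).
  apply: (leq_trans (leq_add (leqnn _) le2)); rewrite !card_missed_switch //.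
  by rewrite [X in X + _]addnC addnACA [X in X + _]addnC !cardsID dM dN.
have swE u : u \notin O -> M u = u -> switch O N M u = u.
  by move=> uO; rewrite ffunE (negPf uO).
have swy : switch O N M y = y by rewrite ffunE yO.
have [xO|xO] := boolP (x \in O); last first.
  move/negP: nxy; apply; apply/existsP; exists (switch O N M).
  by rewrite optS swE // swy !eqxx.
have [zO|zO] := boolP (z \in O); last first.
  move/negP: nyz; apply; apply/existsP; exists (switch O N M).
  by rewrite optS swy swE // !eqxx.
move/negP: xz; apply; apply/eqP; move: xO zO; rewrite !inE.
exact: alternating_end.
Qed.

(** Adding the edge [x y] to a matching that misses both ends would beat the minimum. *)
Lemma adjacent_inseparable x y : x \in A -> y \in A -> e x y -> inseparable x y.
Proof.
move=> xA yA exy; rewrite /inseparable; have [//|xy /=] := eqVneq x y.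
apply/existsP=> -[m /and3P[/andP[mm /eqP dm] /eqP mx /eqP my]].
have /matchingP[mK mE] := mm.
pose m' := [ffun u => if u == x then y else if u == y then x else m u].
have m'x : m' x = y by rewrite ffunE eqxx.
have m'y : m' y = x by rewrite ffunE eqxx eq_sym (negPf xy).
have m'N u : u != x -> u != y -> m' u = m u.
  by move=> ux uy; rewrite ffunE (negPf ux) (negPf uy).
have mm' : matching A m'.
  apply/matchingP; split=> u; have [->|ux] := eqVneq u x.
  - by rewrite m'x m'y.
  - have [->|uy] := eqVneq u y; first by rewrite m'y m'x.
    rewrite (m'N u) // m'N ?mK //; first by rewrite -mx (inj_eq (inv_inj mK)).
    by rewrite -my (inj_eq (inv_inj mK)).
  - by rewrite m'x.
  - have [->|uy] := eqVneq u y; first by rewrite m'y e_sym.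
    by rewrite m'N //; apply: mE.
have := min_d mm'; rewrite leqNgt => /negP; apply; rewrite -dm.
apply: proper_card; apply/properP; split; last first.
  by exists x; rewrite !inE xA ?mx ?eqxx // m'x eq_sym.
apply/subsetP=> u; rewrite !inE => /andP[->].
have [->|ux] := eqVneq u x; first by rewrite mx eqxx.
have [->|uy] := eqVneq u y; first by rewrite my eqxx.
by rewrite m'N.
Qed.

(** When every vertex is missed by some optimal matching, inseparability is an equivalence. Adjacent
    vertices share a class, and an optimal matching misses at most one vertex per class, so its [d]
    missed vertices need [d] classes. *)
Lemma inseparable_partition :
  {in A, forall v, exists2 m, optimal m & m v = v} ->
  (exists m, optimal m) ->
  exists P : {set {set T}}, [/\ partition P A,
    {in P &, forall B C : {set T}, B != C -> {in B & C, forall x y, ~~ e x y}} &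
    d <= #|P|].
Proof.
move=> missable [m optm].
have eqR : {in A & &, equivalence_rel inseparable}.
  move=> x y z xA yA zA; split=> [|xy]; first by rewrite /inseparable eqxx.
  apply/idP/idP=> [xz|yz].
    by apply: (inseparable_trans (missable x xA)); rewrite // inseparable_sym.
  exact: (inseparable_trans (missable y yA)) xy yz.
pose P := equivalence_partition inseparable A.
have partP : partition P A := equivalence_partitionP eqR.
have tI := partition_trivIset partP.
have cP : cover P = A := cover_partition partP.
exists P; split=> //.
  move=> B C BP CP BC x y xB yC; apply: contra BC => exy.
  have xA : x \in A by rewrite -cP; apply/bigcupP; exists B.
  have yA : y \in A by rewrite -cP; apply/bigcupP; exists C.
  rewrite -(def_pblock tI BP xB) -(def_pblock tI CP yC).
  rewrite eq_pblock ?cP // pblock_equivalence_partition //.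
  exact: adjacent_inseparable.
have /andP[_ /eqP<-] := optm.
have pI : {in missed A m &, injective (pblock P)}.
  move=> x y; rewrite !inE => /andP[xA mx] /andP[yA my] /eqP.
  rewrite eq_pblock ?cP // pblock_equivalence_partition //.
  case/predU1P=> // /existsP[]; exists m.
  by rewrite optm mx.
rewrite -(card_in_imset pI); apply/subset_leq_card/subsetP=> _ /imsetP[x xm ->].
by apply: pblock_mem; rewrite cP; move: xm; rewrite inE => /andP[].
Qed.

End Optimal.

(** Hard half of the Berge-Tutte formula, with separated parts in place of odd components. A vertex
    covered by every optimal matching is moved into [S], which raises the deficiency; once there is
    none, Gallai's lemma applies with [S] empty. *)
Theorem deficiency_partition (A : {set T}) d :
  (forall m, matching A m -> d <= #|missed A m|) ->
  exists (S : {set T}) (P : {set {set T}}), [/\ S \subset A, partition P (A :\: S),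
    {in P &, forall B C : {set T}, B != C -> {in B & C, forall x y, ~~ e x y}} &
    d + #|S| <= #|P|].
Proof.
have [k leAk] := ubnP #|A|; elim: k => // k IH in A d leAk * => min_d.
case: (arg_minnP (fun m => #|missed A m|) (matching_id A)) => m0 mm0 min_m0.
have d_le := min_d _ mm0.
pose D := #|missed A m0|; have optm0 : optimal A D m0 by rewrite /optimal mm0 /=.
have [/exists_inP[v vA /forallP cov]|] :=
  boolP [exists v in A, [forall m, optimal A D m ==> (m v != v)]]; last first.
  rewrite negb_exists_in => /forall_inP missable.
  have [v vA||P [partP sepP leP]] := @inseparable_partition A D min_m0.
  - have:= missable v vA; rewrite negb_forall => /existsP[m].
    by rewrite negb_imply negbK => /andP[om /eqP]; exists m.
  - by exists m0.
  exists set0, P; rewrite sub0set setD0 cards0 addn0; split=> //.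
  exact: leq_trans leP.
have ltAv : #|A :\ v| < k by move: leAk; rewrite (cardsD1 v) vA.
have [m mm|S [P [sSA partP sepP leP]]] := IH (A :\ v) D.+1 ltAv.
  have mmA : matching A m.
    have /matchingP[mK mE] := mm; apply/matchingP; split=> // x /mE[+ ->].
    by case/setD1P.
  have mv : m v = v.
    have /matchingP[_ mE] := mm; apply/eqP/negPn/negP=> /mE[].
    by rewrite setD11.
  have misE : #|missed A m| = #|missed (A :\ v) m|.+1.
    rewrite (cardsD1 v) !inE vA mv eqxx; congr _.+1; apply: eq_card => x.
    by rewrite !inE andbA.
  have := min_m0 m mmA; rewrite -/D misE leq_eqVlt ltnS => /predU1P[eqD|].
    by have:= cov m; rewrite /optimal mmA misE -eqD eqxx mv eqxx.
  (* Here [m] misses [v], so it is not optimal on [A]; missing exactly [D.+1] vertices of [A] is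
     ruled out by parity. *)
  rewrite leq_eqVlt => /predU1P[eqD|//].
  have := odd_missed mmA; rewrite -(odd_missed mm0) misE -/D eqD /=.
  by case: (odd _).
exists (v |: S), P; split=> //.
- apply/subsetP=> x /setU1P[->//|/(subsetP sSA)].
  by case/setD1P.
- by rewrite -setDDl.
- apply: leq_trans leP; rewrite cardsU1 addSnnS leq_add //.
  by case: (_ \notin _).
Qed.

End Matching.

(** * Barriers *)

Section Barrier.

Variable G : sgraph.

Definition separated (P : {set {set G}}) :=
  {in P &, forall B C : {set G}, B != C -> {in B & C, forall x y, ~~ adj x y}}.

Lemma perfect_matching_delete (S : {set G}) (m : {ffun G -> G}) :
  matching (@adj G) (~: S) m -> missed (~: S) m = set0 ->
  exists M : {set {set delete S}}, perfect_matching M.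
Proof.
move=> mm mis0; have /matchingP[mK mE] := mm.
(* The default value [u] is never taken, because [m] preserves the complement of [S]. *)
pose m' (u : delete S) : delete S := insubd u (m (val u)).
have m'E u : val (m' u) = m (val u).
  rewrite val_insubd; case: ifP => // /negbT; rewrite negbK => mS.
  have := matching_moved (val u) mm; rewrite !inE mS /=.
  by rewrite (valP u).
have m'K : involutive m' by move=> u; apply: val_inj; rewrite !m'E.
exists [set [set u; m' u] | u in [set: delete S]]%SET; split; last first.
  by apply: partition_pairs => // u; rewrite inE.
move=> _ /imsetP[u _ ->]; exists u, (m' u); split=> //.
have mu : m (val u) != val u.
  apply/eqP=> mu; move/setP/(_ (val u)): mis0.
  by rewrite !inE mu eqxx (valP u).
by rewrite /= /delete_adj m'E; case: (mE _ mu).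
Qed.

(** If deleting [S0] leaves no perfect matching, parity forces at least two missed vertices. The
    barrier is then [S0] together with the set given by [deficiency_partition] for [d = 2]. *)
Lemma factor_critical_barrier k :
  odd #|G| = odd k ->
  (forall (S : {set G}) (P : {set {set G}}), k <= #|S| ->
    partition P (~: S) -> separated P -> #|S| + 2 <= #|P| + k -> False) ->
  factor_critical k G.
Proof.
move=> oddG noS S0 cardS0.
have [/existsP[m /andP[mm /eqP mis]]|/existsPn nom] :=
  boolP [exists m, matching (@adj G) (~: S0) m && (missed (~: S0) m == set0)].
  exact: perfect_matching_delete mm mis.
have min2 m : matching (@adj G) (~: S0) m -> 2 <= #|missed (~: S0) m|.
  move=> mm; have := nom m; rewrite mm -cards_eq0 /=.
  have := odd_missed mm; have := cardsC S0; rewrite cardS0 => cG.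
  by move: oddG; rewrite -cG oddD; case: #|missed _ _| => [|[]] //=; do 2!case: odd.
have [S [P [SS partP sepP le_P]]] := deficiency_partition (@adj_sym G) min2.
have cU : #|S0 :|: S| = k + #|S|.
  rewrite cardsU cardS0 disjoint_setI0 ?cards0 ?subn0 //.
  by rewrite disjoint_sym -[S0]setCK disjoints_subset setCK.
case: (noS (S0 :|: S) P) => //.
- by rewrite cU leq_addr.
- by rewrite setCU -setDE.
- by rewrite cU; lia.
Qed.

Variables (S : {set G}) (P : {set {set G}}).
Hypotheses (partP : partition P (~: S)) (sepP : separated P).

Lemma card_barrier : #|S| + \sum_(B in P) #|B| = #|G|.
Proof. by rewrite -(card_partition partP) cardsC. Qed.

Lemma block_nonempty B : B \in P -> 0 < #|B|.
Proof.
move=> BP; rewrite card_gt0; apply: contraTneq BP => ->.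
by case/and3P: partP.
Qed.

Lemma adj_pblock x y :
  x \notin S -> y \notin S -> adj x y -> pblock P x = pblock P y.
Proof.
move=> xS yS; have cP := cover_partition partP.
have xP : x \in cover P by rewrite cP inE.
have yP : y \in cover P by rewrite cP inE.
apply: contraTeq => neq; apply: (sepP (pblock_mem xP) (pblock_mem yP) neq).
  by rewrite mem_pblock.
by rewrite mem_pblock.
Qed.

Lemma connected_barrier t : t_connected t G -> 1 < #|P| -> t <= #|S|.
Proof.
case=> _ _ conn; case/card_gt1P=> B [C [BP CP BC]].
rewrite leqNgt; apply/negP=> /conn[_ con].
have tI := partition_trivIset partP; have cP := cover_partition partP.
have /card_gt0P[x xB] := block_nonempty BP.
have /card_gt0P[y yC] := block_nonempty CP.
have xS : x \notin S by rewrite -in_setC -cP; apply/bigcupP; exists B.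
have yS : y \notin S by rewrite -in_setC -cP; apply/bigcupP; exists C.
move/eqP: BC; apply; rewrite -(def_pblock tI BP xB) -(def_pblock tI CP yC).
suff aux (u v : delete S) : pblock P (val u) = pblock P (val v).
  exact: (aux (exist _ x xS) (exist _ y yS)).
have /connectP[p] := con u v.
elim: p u => [|w p IH] u /=; first by move=> _ ->.
by move=> /andP[uw /IH{}IH /IH<-]; exact: (adj_pblock (valP u) (valP w) uw).
Qed.

Definition degree (x : G) := #|[set y | adj x y]%SET|.

(** A vertex of [S] has degree at most [#|G|.-1], while a vertex of a part [B] has neighbours only
    in [S] and in [B]. *)
Lemma degree_sum :
  \sum_x degree x <=
  #|S| * #|G|.-1 + #|S| * (#|G| - #|S|) + \sum_(B in P) #|B| * #|B|.-1.
Proof.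
have degS x : degree x <= #|G|.-1.
  rewrite -cardsT (cardsD1 x) inE /=; apply/subset_leq_card/subsetP=> y.
  by rewrite !inE andbT; apply: contraTneq => ->; rewrite adj_irrefl.
have degB B x : B \in P -> x \in B -> degree x <= #|S| + #|B|.-1.
  move=> BP xB; rewrite (cardsD1 x B) xB /=.
  apply: leq_trans (leq_card_setU _ _); apply/subset_leq_card/subsetP=> y.
  rewrite !inE => xy; have [//|yS] := boolP (y \in S) => /=.
  have tI := partition_trivIset partP; have cP := cover_partition partP.
  have xS : x \notin S by rewrite -in_setC -cP; apply/bigcupP; exists B.
  have := adj_pblock xS yS xy; rewrite (def_pblock tI BP xB) => ->.
  rewrite mem_pblock cP inE yS andbT.
  by apply: contraTneq xy => ->; rewrite adj_irrefl.
rewrite (bigID (mem S)) /= -addnA; apply: leq_add.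
  by rewrite -sum_nat_const; apply: leq_sum => x _.
have -> : \sum_(x | x \notin S) degree x = \sum_(B in P) \sum_(x in B) degree x.
  rewrite -big_trivIset ?(partition_trivIset partP) // (cover_partition partP).
  by apply: eq_bigl => x; rewrite inE.
have -> : #|G| - #|S| = \sum_(B in P) #|B| by rewrite -card_barrier addKn.
rewrite big_distrr /= -big_split /=; apply: leq_sum => B BP.
rewrite mulnC -mulnDr -sum_nat_const; apply: leq_sum => x xB; exact: degB.
Qed.

End Barrier.

(** * Superadditivity of [x * (x + 1)], to be applied to part sizes minus one *)

Section Excess.

Variables (I : finType) (a : I -> nat).

Lemma sum_mulSn_le (A : {set I}) :
  \sum_(i in A) a i * (a i).+1 <= (\sum_(i in A) a i) * (\sum_(i in A) a i).+1.
Proof.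
elim/big_ind2: _ => // x1 x2 y1 y2 le1 le2; nia.
Qed.

(** Splitting a total into [x + y] loses [2 * x * y], and [x * y >= x + y - 1] for positive [x] and
    [y]. *)
Lemma sum_mulSn_lt (A : {set I}) j : j \in A -> 0 < a j < \sum_(i in A) a i ->
  \sum_(i in A) a i * (a i).+1 + 2 * (\sum_(i in A) a i).-1 <=
  (\sum_(i in A) a i) * (\sum_(i in A) a i).+1.
Proof.
move=> jA; rewrite (big_setD1 j) //= => aj.
rewrite (big_setD1 j jA) /=; have := sum_mulSn_le (A :\ j); move: aj.
set F := \sum_(i in A :\ j) a i * _; set E := \sum_(i in A :\ j) a i; nia.
Qed.

End Excess.

Local Open Scope ring_scope.

(** * Spectral bounds *)

Section Spectrum.

Variables (R : realType) (G : sgraph).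

Implicit Types (f w : G -> R) (mu b : R).

Definition eigenfunction mu f :=
  (exists x, f x != 0) /\ forall x, \sum_(y | adj x y) f y = mu * f x.

Lemma eigenvalue_eigenfunction mu :
  eigenvalue (adjacency_matrix R G) mu <-> exists f, eigenfunction mu f.
Proof.
have mulE (v : 'rV[R]_#|G|) x :
    (v *m adjacency_matrix R G) 0 (enum_rank x) =
    \sum_(y | adj x y) v 0 (enum_rank y).
  rewrite mxE (reindex enum_rank) /=; last by apply/onW_bij/enum_rank_bij.
  rewrite [RHS]big_mkcond /=; apply: eq_bigr => y _.
  by rewrite mxE !enum_rankK adj_sym; case: adj; rewrite ?mulr1 ?mulr0.
split=> [/eigenvalueP[v vA v0]|[f [[x fx] fA]]].
  exists (fun x => v 0 (enum_rank x)); split=> [|x]; last by rewrite -mulE vA mxE.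
  have /rV0Pn[i vi] := v0; exists (enum_val i); by rewrite enum_valK.
apply/eigenvalueP; exists (\row_i f (enum_val i)).
  apply/rowP=> i; rewrite -(enum_valK i) mulE !mxE enum_rankK -fA.
  by apply: eq_bigr => y _; rewrite mxE enum_rankK.
by apply/rV0Pn; exists (enum_rank x); rewrite mxE enum_rankK.
Qed.

Lemma eigenfunction_max w mu f : (forall x, 0 < w x) -> eigenfunction mu f ->
  exists2 M, 0 < M &
    (exists u, `|f u| = M * w u) /\ forall x, `|f x| <= M * w x.
Proof.
move=> w0 [[x0 fx0] _].
pose r x := `|f x| / w x.
case: (arg_maxP r (erefl true : xpredT x0)) => u _ maxu.
exists (r u).
  by apply: lt_le_trans (maxu x0 isT); rewrite divr_gt0 ?normr_gt0.
split; first by exists u; rewrite /r divfK ?gt_eqF.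
by move=> x; rewrite -ler_pdivrMr //; apply: maxu.
Qed.

(** Collatz-Wielandt bound: evaluate the eigenvalue equation at a vertex where [|f| / w] is
    largest. *)
Lemma weighted_bound w b mu f :
  (forall x, 0 < w x) -> (forall x, \sum_(y | adj x y) w y <= b * w x) ->
  eigenfunction mu f -> `|mu| <= b.
Proof.
move=> w0 wA fE; have [M M0 [[u fu] leM]] := eigenfunction_max w0 fE.
have Mw : 0 < M * w u by rewrite mulr_gt0.
rewrite -(ler_pM2r Mw) -[X in `|mu| * X]fu -normrM -(fE.2 u).
apply: le_trans (ler_norm_sum _ _ _) _.
apply: le_trans (_ : \sum_(y | adj u y) M * w y <= _).
  by apply: ler_sum => y _; apply: leM.
by rewrite -mulr_sumr mulrCA ler_pM2l.
Qed.

(** Where [|f|] meets its bound [M * w], all inequalities of the previous argument are equalities,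
    so every neighbour meets the bound too; connectedness spreads this to all vertices. *)
Lemma weighted_bound_eq w b f mu :
  graph_connected G ->
  (forall x, 0 < w x) -> (forall x, \sum_(y | adj x y) w y <= b * w x) ->
  eigenfunction mu f -> `|mu| = b -> forall x, \sum_(y | adj x y) w y = b * w x.
Proof.
move=> [_ con] w0 wA fE mub.
have [M M0 [[u fu] leM]] := eigenfunction_max w0 fE.
have step x : `|f x| = M * w x ->
    \sum_(y | adj x y) w y = b * w x /\ forall y, adj x y -> `|f y| = M * w y.
  move=> fx; have le1 : b * (M * w x) <= \sum_(y | adj x y) `|f y|.
    by rewrite -mub -fx -normrM -(fE.2 x) ler_norm_sum.
  have le2 : \sum_(y | adj x y) `|f y| <= M * \sum_(y | adj x y) w y.
    by rewrite mulr_sumr; apply: ler_sum => y _; apply: leM.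
  have le3 : M * \sum_(y | adj x y) w y <= b * (M * w x).
    by rewrite mulrCA ler_pM2l.
  split.
    apply/eqP; rewrite eq_le wA /= -(ler_pM2l M0) mulrCA.
    exact: le_trans le1 le2.
  have eq0 : \sum_(y | adj x y) (M * w y - `|f y|) = 0.
    rewrite sumrB -mulr_sumr; apply/eqP; rewrite subr_eq0 eq_le le2 andbT.
    exact: le_trans le3 le1.
  move=> y xy; apply/esym/eqP; rewrite -subr_eq0; apply/eqP.
  by apply: (psumr_eq0P _ eq0) => // z _; rewrite subr_ge0.
move=> x; suff: `|f x| = M * w x by case/step.
have /connectP[p + ->] := con u x.
elim: p u fu => //= v p IH u /step[_ nb] /andP[uv pv].
by apply: IH => //; apply: nb.
Qed.

(* Row sums of the square of the adjacency matrix: the neighbours of [x] have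
   total degree at most [2m - n + 1], since [x] itself accounts for [degree x]
   of the total [2m] and every other vertex for at least [1]. *)
Lemma square_eigenvalue_bound mu f :
  (forall x : G, 0 < degree x)%N -> eigenfunction mu f ->
  mu ^+ 2 + #|G|%:R <= (\sum_(x : G) degree x).+1%:R.
Proof.
move=> deg0 fE.
have [M M0 [[u fu] leM]] := @eigenfunction_max (fun=> 1) mu f (fun=> ltr01) fE.
have {}leM x : `|f x| <= M by have := leM x; rewrite mulr1.
rewrite mulr1 in fu.
have sumA : (\sum_(y | adj u y) degree y + #|G| <= (\sum_(x : G) degree x).+1)%N.
  rewrite [in X in (_ <= X)%N](bigID (adj u)) /= -addnS leq_add2l.
  rewrite (bigD1 u) /=; last by rewrite adj_irrefl.
  have -> : #|G| = (degree u + (1 + \sum_(y | ~~ adj u y && (y != u)) 1))%N.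
    rewrite sum1_card -(cardsC [set y | adj u y]%SET); congr (_ + _)%N.
    rewrite (cardsD1 u) !inE adj_irrefl; congr (_ + _)%N.
    by apply: eq_card => y; rewrite !inE /= andbC.
  by rewrite addnCA add1n ltnS leq_add2l; apply: leq_sum.
(* [mu ^+ 2 * f u] sums [f] over the ends of the walks of length two from [u], and each such value
   is at most [M = |f u|] in absolute value. *)
suff le : mu ^+ 2 <= (\sum_(y | adj u y) degree y)%:R.
  by move: sumA; rewrite -(ler_nat R) natrD; apply: le_trans; rewrite lerD2r.
rewrite -(ger0_norm (sqr_ge0 mu)) -(ler_pM2r M0) -{1}fu -normrM expr2 -mulrA.
rewrite -(fE.2 u) mulr_sumr; apply: le_trans (ler_norm_sum _ _ _) _.
rewrite natr_sum mulr_suml; apply: ler_sum => y _; rewrite -(fE.2 y).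
apply: le_trans (ler_norm_sum _ _ _) _.
apply: le_trans (_ : \sum_(z | adj y z) M <= _); first exact: ler_sum.
by rewrite sumr_const mulr_natl /degree cardsE.
Qed.

Lemma eigenfunction_le_spectral_radius mu f :
  eigenfunction mu f -> mu <= spectral_radius R G.
Proof.
move=> fE; apply: ub_le_sup; last by apply/eigenvalue_eigenfunction; exists f.
exists #|G|%:R => a /eigenvalue_eigenfunction[g gE].
apply: le_trans (ler_norm a) _.
apply: (@weighted_bound (fun=> 1) _ _ g) => // x.
by rewrite mulr1 sumr_const ler_nat max_card.
Qed.

(** The eigenvalues are the finitely many real roots of the characteristic polynomial. The first
    alternative is the default value of [sup] on an empty set. *)
Lemma spectral_radius_attained :
  spectral_radius R G = 0 \/ exists f, eigenfunction (spectral_radius R G) f.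
Proof.
set E := [set a | eigenvalue (adjacency_matrix R G) a]%classic.
have pn0 : char_poly (adjacency_matrix R G) != 0 by rewrite monic_neq0 ?char_poly_monic.
have inE a : (a \in rootsR (char_poly (adjacency_matrix R G))) =
    eigenvalue (adjacency_matrix R G) a.
  by rewrite eigenvalue_root_char -(roots_on_rootsR pn0) in_itv.
case: (rootsR _) inE => [|a0 s] inE.
  left; apply: sup_out => -[[a aE] _]; move: aE; rewrite /E /= -inE.
  by rewrite in_nil.
right; apply/eigenvalue_eigenfunction; rewrite -inE.
have [m m_in m_ub] : exists2 m, m \in a0 :: s & {in a0 :: s, forall a, a <= m}.
  elim: s {inE} a0 => [|a1 s IH] a0.
    by exists a0 => [|a]; rewrite inE // => /eqP->.
  have [m m_in m_ub] := IH a1; exists (Num.max a0 m).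
    by rewrite inE /Num.max; case: ifP; rewrite ?m_in ?eqxx ?orbT.
  by move=> a; rewrite inE le_max => /predU1P[->|/m_ub->]; rewrite ?lexx ?orbT.
suff -> : spectral_radius R G = m by [].
apply/eqP; rewrite eq_le; apply/andP; split.
  apply: ge_sup; first by exists a0; rewrite /E /= -inE mem_head.
  by move=> a; rewrite /= -inE => /m_ub.
have : eigenvalue (adjacency_matrix R G) m by rewrite -inE.
by case/eigenvalue_eigenfunction=> f; apply: eigenfunction_le_spectral_radius.
Qed.

End Spectrum.

(** * Numerical estimates *)

Section Size.

Variables (k r : int).
Hypotheses (k1 : 1 <= k) (r0 : 0 <= r).
Notation t := (k + r).

(* [r = t - k], and [M = 2 s] at the largest possible size [s] of a barrier. *)
Lemma size_bound_last (M : int) : 15 * t + 29 <= 2 * (M + 2) + 9 * k ->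
  0 <= M ^+ 2 - 2 * (4 * t + 1 - 2 * k) * M + 4 * (t ^+ 2 - k + 1).
Proof.
(* [u] is the slack in the hypothesis on [M]; in terms of [u], [r] and [k] the target becomes a sum
   of visibly nonnegative terms. *)
pose u := 2 * M - (15 * r + 6 * k + 25) => h.
have u0 : 0 <= u by rewrite /u; lia.
have ru : 0 <= r * u by apply: mulr_ge0.
have ku : 0 <= k * u by apply: mulr_ge0 => //; lia.
have sq := sqr_ge0 (r - 2 * k); have squ := sqr_ge0 u.
suff : 0 <= 4 * (M ^+ 2 - 2 * (4 * t + 1 - 2 * k) * M + 4 * (t ^+ 2 - k + 1)) by lia.
have -> : 4 * (M ^+ 2 - 2 * (4 * t + 1 - 2 * k) * M + 4 * (t ^+ 2 - k + 1)) =
  u ^+ 2 + 14 * (r * u) + 4 * (k * u) + 46 * u + (r - 2 * k) ^+ 2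
  + 290 * r + 60 * k + 541 by rewrite /u; ring.
lia.
Qed.

(* The difference of the two sides is concave in [s] for fixed [n], so it is
   bounded below by interpolation between [s = t + 1] and [2 s = n + k - 2]. *)
Lemma size_bound_large (p E n s : int) : 0 <= p -> 0 <= E ->
  s = t + 1 + p -> n = 2 * s - k + 2 + E ->
  15 * t + 29 <= 2 * n + 11 * k -> 2 * t ^+ 2 + 5 * t + 4 <= 2 * n ->
  s * (n - 1) + s * (n - s) + E * (E + 1) + 1 <= (n + k - t - 2) ^+ 2 + n.
Proof.
move=> p0 E0 sE nE h1 h2.
have d_last : 0 <= (n + k - 2) ^+ 2 - 2 * (4 * t + 1 - 2 * k) * (n + k - 2)
                 + 4 * (t ^+ 2 - k + 1) by apply: size_bound_last; lia.
have d_first : 0 <= 2 * n - (t - k + 3) - 2 * (t + 1) * (t - k + 2).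
  have -> : 2 * n - (t - k + 3) - 2 * (t + 1) * (t - k + 2) =
    (2 * n - 2 * t ^+ 2 - 5 * t - 4) + 2 * (k - 1) * (t + 1) + (k - 1) by ring.
  have : 0 <= (k - 1) * (t + 1) by apply: mulr_ge0; lia.
  lia.
set d1 := 2 * n - _ - _ in d_first; set dM := _ + _ in d_last.
pose d := (n + k - t - 2) ^+ 2 + n - 1 - (s * (n - 1) + s * (n - s) + E * (E + 1)).
suff : 0 <= d by rewrite /d; lia.
(* For fixed [n] the length [2 * p + E] is constant. [d1] is [d] at the end [p = 0], [dM] is four
   times [d] at the end [E = 0], and the last term is the surplus due to concavity. *)
have key : 4 * (2 * p + E) * d =
    4 * (d1 * E) + 2 * (dM * p) + 6 * (p * E * (2 * p + E)).
  by rewrite /d /d1 /dM nE sE; ring.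
have [L0|L0] := eqVneq (2 * p + E) 0.
  suff -> : d = d1 by [].
  have p00 : p = 0 by lia.
  have E00 : E = 0 by lia.
  by rewrite /d /d1 nE sE p00 E00; ring.
have Lpos : 0 < 4 * (2 * p + E) by lia.
rewrite -(pmulr_rge0 _ Lpos) key.
have := mulr_ge0 d_first E0; have := mulr_ge0 d_last p0.
have : 0 <= p * E * (2 * p + E) by rewrite !mulr_ge0 //; lia.
lia.
Qed.

(** Case [s = t]. The term [2 * (E - 1)] is the loss guaranteed by either an additional part or a
    second nontrivial part. *)
Lemma size_bound_equal (E n : int) : 0 <= E -> n = t + r + 2 + E ->
  2 * t ^+ 2 + 5 * t + 4 <= 2 * n ->
  t * (n - 1) + t * (n - t) + E * (E + 1) - 2 * (E - 1) + 1
   <= (n + k - t - 2) ^+ 2 + n.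
Proof.
move=> E0 nE h2.
suff : 0 <= (2 * n - 2 * t ^+ 2 - 5 * t - 4) + 2 * (k - 1) * t by rewrite nE; lia.
by apply: addr_ge0; [lia | rewrite !mulr_ge0 //; lia].
Qed.

End Size.

(** * The extremal graph *)

Lemma fiber_bijection (X Y : finType) (I : eqType) (f : X -> I) (g : Y -> I) (y0 : Y) :
  (forall i, #|[pred x | f x == i]| = #|[pred y | g y == i]|) -> #|X| = #|Y| ->
  exists2 h : X -> Y, bijective h & forall x, g (h x) = f x.
Proof.
move=> cardfg cardXY.
(* [h] matches the two fibres position by position; equal fibre sizes keep the index in range, so
   the default [y0] is never returned. *)
pose h x := nth y0 (enum [pred y | g y == f x]) (index x (enum [pred x' | f x' == f x])).
have lt_h x : (index x (enum [pred x' | f x' == f x]) < size (enum [pred y | g y == f x]))%N.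
  by rewrite -cardE -cardfg cardE index_mem mem_enum inE.
have gh x : g (h x) = f x.
  by have := mem_nth y0 (lt_h x); rewrite mem_enum inE => /eqP.
exists h => //; apply: inj_card_bij; last by rewrite cardXY.
move=> x x' hx; have fx : f x = f x' by rewrite -!gh hx.
move: hx (lt_h x') (lt_h x); rewrite /h -fx => /eqP + lt' lt.
rewrite nth_uniq ?enum_uniq // => /eqP eqi.
have mem z : f z = f x -> z \in enum [pred z | f z == f x].
  by move=> fz; rewrite mem_enum inE fz.
by rewrite -(nth_index x (mem x erefl)) eqi nth_index // mem.
Qed.

Section Template.

(* [Some true] marks the vertices of [K_t], [Some false] those of the large
   clique and [None] the isolated vertices joined to [K_t]. *)
Definition template (T : finType) (cl : T -> option bool) : rel T := fun u v =>
  (u != v) && [|| cl u == Some true, cl v == Some true |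
                  (cl u == Some false) && (cl v == Some false)].

Definition template_sizes (T : finType) (cl : T -> option bool) (t c r : nat) :=
  [/\ #|[pred x | cl x == Some true]| = t, #|[pred x | cl x == Some false]| = c &
      #|[pred x | cl x == None]| = r].

Variables (R : realType) (t c r : nat).

Lemma template_sum (V : pzSemiRingType) (T : finType) (cl : T -> option bool)
    (w : option bool -> V) :
  template_sizes cl t c r ->
  \sum_x w (cl x) = t%:R * w (Some true) + c%:R * w (Some false) + r%:R * w None.
Proof.
move=> [<- <- <-].
have part i : \sum_(x | cl x == i) w (cl x) = #|[pred x | cl x == i]|%:R * w i.
  rewrite mulr_natl -sumr_const; apply: eq_big => [x|x /eqP->//].
  by rewrite inE.
rewrite (bigID (fun x => cl x == Some true)) /= part -addrA; congr (_ + _).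
rewrite (bigID (fun x => cl x == Some false)) /=; congr (_ + _).
  by rewrite -part; apply: eq_bigl => x; case: (cl x) => [[]|].
by rewrite -part; apply: eq_bigl => x; case: (cl x) => [[]|].
Qed.

(** The three types form an equitable partition, so an eigenvector of the quotient lifts to the
    graph. The subtracted weights remove a vertex from its own clique. *)
Lemma template_neighbors (T : finType) (cl : T -> option bool) (w : option bool -> R)
    (la : R) :
  template_sizes cl t c r ->
  t%:R * w (Some true) + c%:R * w (Some false) + r%:R * w None - w (Some true)
    = la * w (Some true) ->
  t%:R * w (Some true) + c%:R * w (Some false) - w (Some false)
    = la * w (Some false) ->
  t%:R * w (Some true) = la * w None ->
  forall x, \sum_(y | template cl x y) w (cl y) = la * w (cl x).
Proof.
move=> sz eS eC eI x.
have nbr (w' : option bool -> R) : 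
    (forall y, y != x -> w' (cl y) = if template cl x y then w (cl y) else 0) ->
    \sum_(y | template cl x y) w (cl y) = \sum_y w' (cl y) - w' (cl x).
  move=> w'E; rewrite [in RHS](bigD1 x) //= addrC addrK.
  rewrite big_mkcond [LHS](bigD1 x) //= {1}/template eqxx add0r.
  by apply: eq_bigr => y yx; rewrite w'E.
case clx : (cl x) => [[]|].
- by rewrite -eS -(template_sum w sz) -clx; apply: nbr => // y;
    rewrite eq_sym /template clx => ->.
- pose w' i := if i == None then 0 else w i.
  rewrite (nbr w'); first by rewrite (template_sum w' sz) clx /w' /= -eC mulr0 addr0.
  move=> y; rewrite eq_sym /template clx => ->.
  by case: (cl y) => [[]|].
- pose w' i := if i == Some true then w i else 0.
  rewrite (nbr w'); last first.
    by move=> y; rewrite eq_sym /template clx => ->; case: (cl y) => [[]|].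
  by rewrite (template_sum w' sz) clx /w' /= -eI !mulr0 !addr0 subr0.
Qed.

(* Characteristic equation of the quotient matrix of the template. *)
Lemma template_eigenvalue : (0 < t)%N -> (0 < c)%N -> (0 < r)%N ->
  exists (la : R) (w : option bool -> R),
    [/\ c%:R + t%:R - 1 < la, forall i, 0 < w i &
     [/\ t%:R * w (Some true) + c%:R * w (Some false) + r%:R * w None - w (Some true)
           = la * w (Some true),
        t%:R * w (Some true) + c%:R * w (Some false) - w (Some false)
           = la * w (Some false) &
        t%:R * w (Some true) = la * w None]].
Proof.
move=> t_gt0 c_gt0 r_gt0.
have t1 : 1 <= t%:R :> R by rewrite ler1n.
have c1 : 1 <= c%:R :> R by rewrite ler1n.
have r1 : 1 <= r%:R :> R by rewrite ler1n.
move: (t%:R : R) (c%:R : R) (r%:R : R) t1 c1 r1 => T C S T1 C1 S1.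
(* Setting [w (Some true) = 1] and eliminating the other two weights leaves this cubic in [la]. It
   is negative at [C + T - 1] and nonnegative at [C + T - 1 + S * T]. *)
pose p : {poly R} := 'X * ('X - (C - 1)%:P) * ('X - (T - 1)%:P)
   - (C * T) *: 'X - (S * T) *: ('X - (C - 1)%:P).
have pE x : p.[x] = x * (x - (C - 1)) * (x - (T - 1)) - C * T * x - S * T * (x - (C - 1)).
  by rewrite /p !hornerE.
have ST : 0 < S * T by apply: mulr_gt0; lra.
have pa : p.[C + T - 1] = - (S * T * T) by rewrite pE; ring.
have pb : p.[C + T - 1 + S * T] =
   S * T * ((C + T - 1) * (C + T + S * T) + (S * T) * (C + T + S * T) - (T + S * T)).
  by rewrite pE; ring.
have [||la /andP[le_la _] /rootP p0] := @poly_ivt R p (C + T - 1) (C + T - 1 + S * T).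
- by rewrite lerDl ltW.
- rewrite pa pb oppr_le0 !mulr_ge0 ?subr_ge0 //; try lra.
  have : 0 <= (C + T - 2) * (C + T + S * T) by apply: mulr_ge0; lra.
  have : 0 <= (S * T) * (C + T + S * T) by apply: mulr_ge0; lra.
  lra.
have lt_la : C + T - 1 < la.
  rewrite lt_neqAle le_la andbT; apply: contra_eq_neq p0 => <-.
  by rewrite pa oppr_eq0 gt_eqF // mulr_gt0 //; lra.
have la0 : 0 < la by lra.
have lc0 : 0 < la - (C - 1) by lra.
exists la, (fun i => if i is Some b then if b then 1 else T / (la - (C - 1)) else T / la).
split=> //.
  by case=> [[]|] //; apply: divr_gt0 => //; lra.
have la_neq := lt0r_neq0 la0; have lc_neq := lt0r_neq0 lc0.
split; last by rewrite mulr1 mulrC divfK.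
- apply: (mulIf la_neq); apply: (mulIf lc_neq).
  move: p0; rewrite pE => p0; apply/eqP; rewrite -subr_eq0 -oppr_eq0 -p0; apply/eqP.
  by field; rewrite la_neq.
- by field.
Qed.

End Template.

Lemma template_card t c r (T : finType) (cl : T -> option bool) :
  template_sizes cl t c r -> #|T| = (t + c + r)%N.
Proof.
move=> sz; have := template_sum (fun=> 1 : int) sz.
rewrite sumr_const !mulr1 => eqT.
by apply/eqP; rewrite -(eqr_nat int) !natrD -eqT.
Qed.

Lemma template_isomorphic t c r (G H : sgraph) (cG : G -> option bool)
    (cH : H -> option bool) : (0 < t)%N ->
  template_sizes cG t c r -> template_sizes cH t c r ->
  (forall x y, adj x y = template cG x y) ->
  (forall x y, adj x y = template cH x y) -> isomorphic G H.
Proof.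
move=> t0 szG szH adjG adjH.
have [tG nG iG] := szG; have [tH nH iH] := szH.
have /card_gt0P[y0 _] : (0 < #|[pred y | cH y == Some true]|)%N by rewrite tH.
have [||h bh hE] := @fiber_bijection G H _ cG cH y0.
- by case=> [[]|]; rewrite ?tG ?nG ?iG.
- by rewrite (template_card szG) (template_card szH).
exists h => // x y; rewrite adjG adjH /template !hE.
by rewrite (inj_eq (bij_inj bh)).
Qed.

Lemma extremal_template n t k :
  exists2 cl : extremal_graph n t k -> option bool,
    template_sizes cl t (n + k - 2 * t - 1) (t - k + 1) &
    forall x y, adj x y = template cl x y.
Proof.
pose cl (x : extremal_graph n t k) :=
  match x with inl _ => Some true | inr (inl _) => Some false | inr (inr _) => None end.
exists cl; last first.
  move=> [x|[x|[i x]]] [y|[y|[j y]]]; rewrite /template //=.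
  all: rewrite ?andbT ?andbF.
  all: try (by apply/idP/idP; apply: contra => /eqP E; apply/eqP; congruence).
  by rewrite /copies_adj /= [x]ord1 [y]ord1 eqxx andbF.
split; rewrite -sum1_card !big_sumType /= ?sum1_card ?big_pred0_eq ?card_ord.
all: by rewrite ?card0 ?card_prod ?card_ord ?muln1 ?addn0.
Qed.

(** * Spectral radius of the extremal graph *)

Section LowerBound.
Variables (R : realType).

(** The weights depend on types only, so the same [la] and [w] can be used on the vertices of [G]
    once these are classified. The lower bound is the eigenvalue [c + t - 1] of the largest
    clique. *)
Lemma extremal_spectral_radius n t k : (0 < t)%N -> (2 * t + 1 < n + k)%N ->
  exists (la : R) (w : option bool -> R),
   [/\ (n + k)%:R - t%:R - 2 < la, forall i, 0 < w i,
       la <= spectral_radius R (extremal_graph n t k) &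
       forall (T : finType) (cl : T -> option bool),
         template_sizes cl t (n + k - 2 * t - 1) (t - k + 1) ->
         forall x, \sum_(y | template cl x y) w (cl y) = la * w (cl x)].
Proof.
move=> t0 nk; set c := (n + k - 2 * t - 1)%N; set r := (t - k + 1)%N.
have c0 : (0 < c)%N by rewrite /c; lia.
have r0 : (0 < r)%N by rewrite /r; lia.
have [la [w [lt_la w0 [eS eC eI]]]] := template_eigenvalue R t0 c0 r0.
exists la, w; split=> //.
- apply: le_lt_trans lt_la; rewrite /c; have -> : (n + k - 2 * t - 1)%:R = (n + k)%:R - 2 * t%:R - 1 :> R.
    by rewrite !natrB ?natrM //; lia.
  lra.
- have [cl sz adjE] := extremal_template n t k.
  apply: (@eigenfunction_le_spectral_radius _ _ _ (fun x => w (cl x))); split.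
    have /card_gt0P[x _] : (0 < #|[pred x | cl x == Some true]|)%N by case: sz => ->.
    by exists x; rewrite gt_eqF.
  move=> x; rewrite -(template_neighbors sz eS eC eI).
  by apply: eq_bigl => y; apply: adjE.
- by move=> T cl sz x; apply: template_neighbors sz eS eC eI x.
Qed.

End LowerBound.

(** * Structure of a barrier under the spectral hypothesis *)

Section Barrier.

Variables (R : realType) (t k n : nat) (G : sgraph) (S : {set G}) (P : {set {set G}}).
Hypotheses (k_ge1 : (1 <= k)%N) (t_gek : (k <= t)%N) (orderG : #|G| = n).
Hypothesis conG : graph_connected G.
Hypotheses (n_ge1 : (15 * t + 29 <= 2 * n + 11 * k)%N)
           (n_ge2 : (2 * t ^ 2 + 5 * t + 4 <= 2 * n)%N).
Hypotheses (partP : partition P (~: S)) (sepP : separated P).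
Hypotheses (t_leS : (t <= #|S|)%N) (leSP : (#|S| + 2 <= #|P| + k)%N).
Hypothesis rhoG : spectral_radius R (extremal_graph n t k) <= spectral_radius R G.

Notation E := (\sum_(B in P) #|B|.-1)%N.

Let sizeE : (#|S| + (E + #|P|) = n)%N.
Proof.
rewrite -orderG -(card_barrier partP) -[#|P|]sum1_card -big_split /=.
by congr (_ + _)%N; apply: eq_bigr => B /(block_nonempty partP); lia.
Qed.

Lemma degree_gt0 (x : G) : (0 < degree x)%N.
Proof.
have /card_gt1P[y [z [_ _ yz]]] : (1 < #|G|)%N by lia.
have [v xv] : exists v, v != x.
  by have [yx|] := eqVneq y x; [exists z; rewrite -yx eq_sym | exists y].
have /connectP[[|u p] /=] := conG.2 x v; first by move=> _ vx; rewrite vx eqxx in xv.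
by move=> /andP[xu _] _; apply/card_gt0P; exists u; rewrite inE.
Qed.

(** With [a = n + k - t - 2], one has [0 <= a < la <= rho(G)], and Hong's bound turns this into a
    lower bound on the degree sum. It is stated over the integers to meet the size estimates. *)
Lemma degree_sum_gt : ((n + k)%:Z - t%:Z - 2) ^+ 2 + n%:Z < (\sum_(x : G) degree x)%:Z + 1.
Proof.
rewrite ltNge; apply/negP=> le.
have t0 : (0 < t)%N by lia.
have nk : (2 * t + 1 < n + k)%N by move: sizeE; lia.
have [la [w [lt_la _ le_la _]]] := extremal_spectral_radius R t0 nk.
pose a : R := (n + k)%:R - t%:R - 2.
have a0 : 0 <= a.
  by rewrite /a -addrA -opprD subr_ge0 -natrD ler_nat; lia.
have {}le : (\sum_(x : G) degree x)%:R + 1 <= a ^+ 2 + n%:R.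
  move: le; rewrite -(ler_int R) !rmorphD rmorphXn /= !rmorphB /=.
  by rewrite /a -!pmulrn.
case: (spectral_radius_attained R G) => [rho0|[f fE]].
  by move: rhoG; rewrite rho0; move: lt_la le_la; rewrite -/a; lra.
have := square_eigenvalue_bound degree_gt0 fE; rewrite orderG.
apply/negP; rewrite -ltNge -natr1; apply: le_lt_trans le _.
rewrite ltrD2r ltr_pXn2r ?nnegrE //; move: lt_la le_la rhoG; rewrite -/a; lra.
Qed.

Lemma degree_sum_le : (\sum_(x : G) degree x <=
  #|S| * n.-1 + #|S| * (n - #|S|) + \sum_(B in P) #|B|.-1 * #|B|.-1.+1)%N.
Proof.
have := degree_sum partP sepP; rewrite orderG => /leq_trans; apply.
rewrite leq_add2l; apply: leq_sum => B /(block_nonempty partP) B0.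
by rewrite prednK // mulnC.
Qed.

Lemma barrier_size : #|S| = t.
Proof.
apply/eqP; rewrite eqn_leq t_leS andbT leqNgt; apply/negP=> t_ltS.
have := degree_sum_gt; apply/negP; rewrite -leNgt.
have := degree_sum_le; have := sum_mulSn_le (fun B : {set G} => #|B|.-1) P.
set D := (\sum_(x : G) _)%N; set F := (\sum_(B in P) _ * _)%N.
move: sizeE; set e := E => sizeE' F_le D_le.
(* [e0] is the total excess when there are exactly [#|S| - k + 2] parts; more parts only lower
   it. *)
pose e0 : int := n%:Z - 2 * #|S|%:Z + k%:Z - 2.
have e_le : e%:Z <= e0 by rewrite /e0; lia.
have bound := @size_bound_large k%:Z (t%:Z - k%:Z) _ _ (#|S|%:Z - t%:Z - 1) e0 n%:Z #|S|%:Z.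
have {bound} : #|S|%:Z * (n%:Z - 1) + #|S|%:Z * (n%:Z - #|S|%:Z) + e0 * (e0 + 1) + 1 <=
    (n%:Z + k%:Z - (k%:Z + (t%:Z - k%:Z)) - 2) ^+ 2 + n%:Z.
  apply: bound; rewrite /e0; lia.
have : e%:Z * (e%:Z + 1) <= e0 * (e0 + 1) by apply: ler_pM; lia.
have -> : (n + k)%:Z - t%:Z - 2 = n%:Z + k%:Z - (k%:Z + (t%:Z - k%:Z)) - 2 by lia.
move: D_le F_le; rewrite -!lez_nat !PoszD !PoszM -subzn ?PoszD; last by lia.
have -> : n.-1%:Z = n%:Z - 1 by lia.
have -> : e.+1%:Z = e%:Z + 1 by lia.
set X := (_ ^+ 2); lia.
Qed.

(** By [size_bound_equal], falling short of a single part of excess [e0] by [2 * (e0 - 1)] would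
    contradict the lower bound on the degree sum. *)
Lemma blocks_balanced_lt (e0 : int) : e0 = n%:Z - 2 * t%:Z + k%:Z - 2 ->
  e0 * (e0 + 1) < (\sum_(B in P) #|B|.-1 * #|B|.-1.+1)%:Z + 2 * (e0 - 1).
Proof.
move=> e0E; rewrite ltNge; apply/negP=> F_le.
have := degree_sum_gt; apply/negP; rewrite -leNgt.
have := degree_sum_le; rewrite barrier_size; have := sizeE; rewrite barrier_size.
move: leSP F_le; rewrite barrier_size.
set D := (\sum_(x : G) _)%N; set F := (\sum_(B in P) _ * _)%N; set e := E.
move=> P_ge F_le sizeE' D_le.
have {}bound : t%:Z * (n%:Z - 1) + t%:Z * (n%:Z - t%:Z) + e0 * (e0 + 1) - 2 * (e0 - 1) + 1 <=
    (n%:Z + k%:Z - t%:Z - 2) ^+ 2 + n%:Z.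
  have := @size_bound_equal k%:Z (t%:Z - k%:Z) _ _ e0 n%:Z.
  rewrite [k%:Z + (_ - _)]addrC subrK; apply; lia.
have -> : (n + k)%:Z - t%:Z - 2 = n%:Z + k%:Z - t%:Z - 2 by lia.
move: D_le F_le bound; rewrite -!lez_nat !PoszD !PoszM -subzn; last by lia.
have -> : n.-1%:Z = n%:Z - 1 by lia.
set X := (_ ^+ 2); lia.
Qed.

(** An additional part lowers the excess to at most [e0 - 1], which costs at least [2 * e0]. *)
Lemma barrier_count : (#|P| + k = t + 2)%N.
Proof.
apply/eqP; rewrite eqn_leq -{2}barrier_size leSP andbT leqNgt; apply/negP=> P_gt.
pose e0 : int := n%:Z - 2 * t%:Z + k%:Z - 2.
have := @blocks_balanced_lt e0 erefl; apply/negP; rewrite -leNgt.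
have := sum_mulSn_le (fun B : {set G} => #|B|.-1) P.
have := sizeE; rewrite barrier_size.
set F := (\sum_(B in P) _ * _)%N; set e := E => sizeE' F_le.
have e_le : e%:Z <= e0 - 1 by rewrite /e0; lia.
have : e%:Z * (e%:Z + 1) <= (e0 - 1) * e0 by apply: ler_pM; lia.
by move: F_le; rewrite -lez_nat PoszM; lia.
Qed.

(** A nontrivial part without the whole excess costs [2 * (E - 1)] by [sum_mulSn_lt]. If all parts
    are singletons, the excess is zero and any part serves. *)
Lemma barrier_block : exists2 C : {set G}, C \in P & #|C|.-1 = E.
Proof.
have e_eq : E%:Z = n%:Z - 2 * t%:Z + k%:Z - 2.
  by have := sizeE; rewrite barrier_size; have := barrier_count; lia.
have [/exists_inP[C CP C_gt0]|] := boolP [exists C in P, 0 < #|C|.-1]%N.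
  exists C => //; apply/eqP; rewrite eqn_leq {1}(big_setD1 C CP) leq_addr /=.
  rewrite leqNgt; apply/negP=> C_lt; have := blocks_balanced_lt e_eq.
  apply/negP; rewrite -leNgt.
  have := sum_mulSn_lt CP (a := fun B : {set G} => #|B|.-1); rewrite C_gt0 => /(_ C_lt).
  by move: C_lt; set F := (\sum_(B in P) _ * _)%N; set e := E; lia.
rewrite negb_exists_in => /forall_inP all0.
have /card_gt0P[C CP] : (0 < #|P|)%N by have := barrier_count; lia.
exists C => //; rewrite big1 => [|B /all0]; last by rewrite lt0n negbK => /eqP.
by have := all0 C CP; rewrite lt0n negbK => /eqP.
Qed.

Lemma barrier_template : exists2 cl : G -> option bool,
  template_sizes cl t (n + k - 2 * t - 1) (t - k + 1) &
  forall x y, adj x y -> template cl x y.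
Proof.
have [C CP C_eq] := barrier_block.
have tI := partition_trivIset partP; have cP := cover_partition partP.
have C_gt0 := block_nonempty partP CP.
have others B : B \in P -> B != C -> #|B| = 1%N.
  move=> BP BC; have := block_nonempty partP BP.
  suff : #|B|.-1 = 0%N by lia.
  have : (\sum_(D in P :\ C) #|D|.-1 = 0)%N.
    by move: C_eq; rewrite (big_setD1 C CP) /= => /eqP; rewrite -[eqbLHS]addn0 eqn_add2l => /eqP.
  move/eqP; rewrite sum_nat_eq0 => /forall_inP/(_ B); rewrite !inE BC BP.
  by move/(_ isT)/eqP.
have CS x : x \in C -> x \notin S.
  by move=> xC; rewrite -in_setC -cP; apply/bigcupP; exists C.
pose cl x := if x \in S then Some true else if x \in C then Some false else None.
have clS : #|[pred x | cl x == Some true]| = t.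
  rewrite -barrier_size; apply: eq_card => x; rewrite inE /cl.
  by case: (x \in S); case: (x \in C).
have clC : #|[pred x | cl x == Some false]| = #|C|.
  apply: eq_card => x; rewrite inE /cl; have := CS x.
  by case: (x \in C) => [/(_ isT)/negPf->|]; case: (x \in S).
have sizeC : #|C| = (n + k - 2 * t - 1)%N.
  by move: C_eq sizeE barrier_count C_gt0; rewrite barrier_size; lia.
exists cl.
  split; rewrite ?clC //; have := template_card (And3 clS clC erefl).
  by rewrite orderG sizeC; move: sizeE barrier_count; rewrite barrier_size; lia.
move=> x y xy; have xNy : x != y by apply: contraTneq xy => ->; rewrite adj_irrefl.
rewrite /template xNy /cl; have [//|xS] := boolP (x \in S).
have [_|yS] := boolP (y \in S); first by rewrite orbT.
have pxy := adj_pblock partP sepP xS yS xy.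
have xP : x \in cover P by rewrite cP inE.
have yP : y \in cover P by rewrite cP inE.
have px : x \in pblock P x by rewrite mem_pblock.
have py : y \in pblock P x by rewrite pxy mem_pblock.
have [<-|neq] := eqVneq (pblock P x) C; first by rewrite px py.
have /eqP/cards1P[z zE] := others _ (pblock_mem xP) neq.
by move: xNy px py; rewrite zE !inE => /eqP + /eqP xz /eqP yz; rewrite xz yz.
Qed.

(** Since [G] lies inside the template, the weights satisfy the Collatz-Wielandt condition with
    [la], so [rho(G) <= la <= rho(H) <= rho(G)] for the extremal graph [H]. The equality case makes
    the weights an eigenfunction of [G] itself. *)
Lemma barrier_isomorphic : isomorphic G (extremal_graph n t k).
Proof.
have t0 : (0 < t)%N by lia.
have nk : (2 * t + 1 < n + k)%N by move: sizeE; lia.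
have [cl sz sub] := barrier_template.
have [la [w [lt_la w0 le_la wE]]] := extremal_spectral_radius R t0 nk.
have la0 : 0 < la.
  apply: le_lt_trans lt_la; rewrite -addrA -opprD subr_ge0 -natrD ler_nat; lia.
have wA x : \sum_(y | adj x y) w (cl y) <= la * w (cl x).
  rewrite -(wE _ _ sz) big_mkcond [leRHS]big_mkcond /=; apply: ler_sum => y _.
  by case: ifP => [/sub->//|_]; case: ifP => // _; apply: ltW.
have w0' x : 0 < w (cl x) by [].
have la_le := le_trans le_la rhoG.
have [rho0|[f fE]] := spectral_radius_attained R G.
  by move: la_le la0; rewrite rho0; lra.
have rho_la : `|spectral_radius R G| = la.
  apply/eqP; rewrite eq_le (weighted_bound w0' wA fE).
  exact: le_trans la_le (ler_norm _).
have eqA := weighted_bound_eq conG w0' wA fE rho_la.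
have [cl' sz' adjH] := extremal_template n t k.
apply: (template_isomorphic t0 sz sz') => // x y.
apply/idP/idP=> [/sub//|xy]; apply: contraT => nxy.
(* An edge [x y] of the template absent from [G] would leave the positive term [w (cl y)] in the
   difference of the two neighbour sums. *)
have := eqA x; rewrite -(wE _ _ sz) => /esym/eqP.
rewrite (bigID (adj x)) /= -subr_eq0 addrAC.
rewrite (eq_bigl (adj x)) => [|z]; last first.
  by apply/andP/idP=> [[]//|xz]; rewrite sub.
rewrite subrr add0r gt_eqF // (bigD1 y) /=; last by rewrite xy.
by apply: ltr_pwDl => //; apply: sumr_ge0 => z _; apply: ltW.
Qed.

End Barrier.

Theorem theorem1p8 (R : realType) (t k n : nat) (G : sgraph)
  (k_ge1 : (1 <= k)%N) (t_gek : (k <= t)%N)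
  (orderG : #|G| = n)
  (connG : t_connected t G)
  (n_ge : Num.max ((15 * t%:R - 11 * k%:R + 29) / 2)
                  (t%:R ^+ 2 + 5 / 2 * t%:R + 2) <= n%:R :> R)
  (n_parity : n = k %[mod 2])
  (rhoG : spectral_radius R (extremal_graph n t k) <= spectral_radius R G) :
  ~ isomorphic G (extremal_graph n t k) -> factor_critical k G.
Proof.
move=> not_iso; apply: factor_critical_barrier => [|S P kS partP sepP leSP].
  by move: n_parity; rewrite orderG !modn2; do 2!case: odd.
move: n_ge; rewrite ge_max => /andP[n_ge1 n_ge2]; apply: not_iso.
have [conG _ _] := connG.
apply: (@barrier_isomorphic R t k n G S P) => //.
(* The real bounds are doubled to clear denominators, and [11 * k] changes sides to avoid truncated
   subtraction. *)
- rewrite -(ler_nat R) (natrD _ (15 * t)) (natrD _ (2 * n)).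
  by rewrite (natrM _ 15) (natrM _ 2) (natrM _ 11); lra.
- rewrite -(ler_nat R) (natrD _ (2 * t ^ 2 + 5 * t)) (natrD _ (2 * t ^ 2)).
  rewrite (natrM _ 2) (natrM _ 5) (natrM _ 2 n) natrX.
  lra.
- by apply: (connected_barrier partP sepP connG); lia.
Qed.
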